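(* Let $n\ge1$ and $t\in\mathbb{N}$. (i) Every SOS polynomial in the interior of $\Sigma_t$ is the reciprocal of the Christoffel function $\Lambda^{\boldsymbol{\phi}}_t$ of some linear functional $L_{\boldsymbol{\phi}}$ with $\boldsymbol{\phi}\in\mathrm{int}(\Sigma_t^* )$. That is, $p\in\mathrm{int}(\Sigma_t)$ if and only if $$p(\mathbf{x})=\mathbf{v}_t(\mathbf{x})^T\,\mathbf{M}_t(\boldsymbol{\phi})^{-1}\,\mathbf{v}_t(\mathbf{x})\,,\qquad\forall\,\mathbf{x}\in\mathbb{R}^n,$$ for some moment sequence $\boldsymbol{\phi}\in\mathrm{int}(\Sigma_t^* )$. Therefore $p^{-1}$ is the Christoffel function $\Lambda_t^{\boldsymbol{\phi}}$ associated with some linear functional $\boldsymbol{\phi}$ (with not necessarily a representing measure). (ii) In addition, if $p\in\mathrm{int}(\Sigma_t)$ is univariate (i.e. $n=1$), then $\boldsymbol{\phi}$ has a representing measure $\phi$, and so $p^{-1}$ is the Christoffel function $\Lambda^\phi_t$ of some measure $\phi$ on the real line.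
   Context: Let $\mathbb{N}^n_t=\{\boldsymbol{\alpha}\in\mathbb{N}^n:|\boldsymbol{\alpha}|\le t\}$, let $\mathbb{R}[\mathbf{x}]_{t}$ be the space of real polynomials in $\mathbf{x}=(x_1,\ldots,x_n)$ of total degree at most $t$, and $\mathbf{v}_t(\mathbf{x})=(\mathbf{x}^{\boldsymbol{\alpha}})_{\boldsymbol{\alpha}\in\mathbb{N}^n_t}$ the vector of monomials of degree at most $t$. $\Sigma_t=\Sigma[\mathbf{x}]_t\subset\mathbb{R}[\mathbf{x}]_{2t}$ is the convex cone of polynomials of degree at most $2t$ that are sums of squares (SOS) of polynomials; its interior is taken in $\mathbb{R}[\mathbf{x}]_{2t}$. For a real sequence $\boldsymbol{\phi}=(\phi_{\boldsymbol{\alpha}})_{\boldsymbol{\alpha}\in\mathbb{N}^n_{2t}}$, the Riesz functional is $L_{\boldsymbol{\phi}}(\sum_{\boldsymbol{\alpha}} p_{\boldsymbol{\alpha}}\mathbf{x}^{\boldsymbol{\alpha}})=\sum_{\boldsymbol{\alpha}} p_{\boldsymbol{\alpha}}\phi_{\boldsymbol{\alpha}}$ on $\mathbb{R}[\mathbf{x}]_{2t}$, and the moment matrix $\mathbf{M}_t(\boldsymbol{\phi})$ is indexed by $\mathbb{N}^n_t$ with entries $\mathbf{M}_t(\boldsymbol{\phi})(\boldsymbol{\alpha},\boldsymbol{\beta})=\phi_{\boldsymbol{\alpha}+\boldsymbol{\beta}}$. The dual cone is $\Sigma_t^*=\{\boldsymbol{\phi}=(\phi_{\boldsymbol{\alpha}})_{\boldsymbol{\alpha}\in\mathbb{N}^n_{2t}}:\mathbf{M}_t(\boldsymbol{\phi})\succeq0\}$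 ($\succeq0$: positive semidefinite), with interior taken in the space of real sequences indexed by $\mathbb{N}^n_{2t}$. When $\mathbf{M}_t(\boldsymbol{\phi})$ is positive definite, the Christoffel function is $\Lambda^{\boldsymbol{\phi}}_t(\mathbf{x})=[\mathbf{v}_t(\mathbf{x})^T\mathbf{M}_t(\boldsymbol{\phi})^{-1}\mathbf{v}_t(\mathbf{x})]^{-1}$. The sequence $\boldsymbol{\phi}$ has a representing measure if there is a Borel measure $\phi$ on $\mathbb{R}^n$ with $\int\mathbf{x}^{\boldsymbol{\alpha}}d\phi=\phi_{\boldsymbol{\alpha}}$ for all $\boldsymbol{\alpha}\in\mathbb{N}^n_{2t}$; then one writes $\Lambda^\phi_t$ for $\Lambda^{\boldsymbol{\phi}}_t$. *)

(* Defs.v *)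
From HB Require Import structures.
From mathcomp Require Import all_boot all_order all_algebra.
From mathcomp Require Import all_classical all_reals all_analysis.
(* The notations of mpoly clash with those of mathcomp-analysis. *)
From mathcomp Require Import -(notations) mpoly.

Set Implicit Arguments.
Unset Strict Implicit.
Unset Printing Implicit Defensive.

Import Order.TTheory GRing.Theory Num.Theory.
Import numFieldNormedType.Exports.

Local Open Scope classical_set_scope.
Local Open Scope ring_scope.

(* $\mathbb{N}^n_t$: [bmultinom n k] is the finite type of the multi-indices of
   degree < k. *)
Definition midx (n t : nat) := bmultinom n t.+1.

(* Families indexed by [midx n t] are stored as row or column vectors through
   the enumeration of the finite type [midx n t], so that the matrix theory and
   the product topology of matrices apply to them. *)
Notation nmidx n t := #|{: midx n t}|.

Section Monomials.
Context {R : realType} {n : nat}.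

Definition monom (x : 'rV[R]_n) (a : multinom n) : R := mmap1 (x 0) a.

Definition vmonom (t : nat) (x : 'rV[R]_n) : 'cV[R]_(nmidx n t) :=
  \col_i monom x (enum_val i : midx n t).

Definition peval (p : mpoly n R) (x : 'rV[R]_n) : R := meval (x 0) p.

(* [msize p] is one plus the total degree, and [msize 0 = 0]. *)
Definition mdeg_le (d : nat) (p : mpoly n R) : Prop := (msize p <= d.+1)%N.

Definition SOS (t : nat) : set (mpoly n R) :=
  [set p | mdeg_le (2 * t) p /\
    exists s : seq (mpoly n R), p = \sum_(q <- s) q ^+ 2].

Definition mcoefs (d : nat) (p : mpoly n R) : 'rV[R]_(nmidx n d) :=
  \row_i mcoeff (enum_val i : midx n d) p.

(* [mcoefs (2 * t)] is a linear isomorphism from the polynomials of degree at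
   most 2t onto the coefficient space, which provides the topology. *)
Definition SOS_int (t : nat) : set (mpoly n R) :=
  [set p | mdeg_le (2 * t) p /\
    interior (mcoefs (2 * t) @` SOS t) (mcoefs (2 * t) p)].

End Monomials.

Arguments SOS R n t : clear implicits.
Arguments SOS_int R n t : clear implicits.

Section MomentMatrix.
Context {R : realType} {n : nat}.

Definition seq_at (t : nat) (phi : 'rV[R]_(nmidx n t)) (a : midx n t) : R :=
  phi 0 (enum_rank a).

Lemma madd_subproof (t : nat) (a b : midx n t) :
  (mdeg (mnm_add a b) < (2 * t).+1)%N.
Proof.
by rewrite mdegD mul2n -addnn ltnS leq_add // -ltnS bmdeg.
Qed.

Definition madd (t : nat) (a b : midx n t) : midx n (2 * t) :=
  BMultinom (madd_subproof a b).

Definition moment_mx (t : nat) (phi : 'rV[R]_(nmidx n (2 * t))) :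
    'M[R]_(nmidx n t) :=
  \matrix_(i, j) seq_at phi (madd (enum_val i) (enum_val j)).

Definition psdmx (m : nat) (A : 'M[R]_m) : Prop :=
  A^T = A /\ forall v : 'cV[R]_m, 0 <= (v^T *m A *m v) 0 0.

Definition pdmx (m : nat) (A : 'M[R]_m) : Prop :=
  A^T = A /\ forall v : 'cV[R]_m, v != 0 -> 0 < (v^T *m A *m v) 0 0.

Definition SOS_dual (t : nat) : set 'rV[R]_(nmidx n (2 * t)) :=
  [set phi | psdmx (moment_mx phi)].

(* Only meaningful when [moment_mx phi] is invertible: [invmx] is the identity
   on singular matrices. *)
Definition christoffel (t : nat) (phi : 'rV[R]_(nmidx n (2 * t)))
    (x : 'rV[R]_n) : R :=
  (((vmonom t x)^T *m invmx (moment_mx phi) *m vmonom t x) 0 0)^-1.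

Definition is_christoffel (t : nat) (phi : 'rV[R]_(nmidx n (2 * t)))
    (f : 'rV[R]_n -> R) : Prop :=
  pdmx (moment_mx phi) /\ forall x, f x = christoffel phi x.

End MomentMatrix.

Arguments SOS_dual R n t : clear implicits.

(* $\mathbb{R}^n$ with its Borel sigma-algebra. *)
Notation borel_space R n := (g_sigma_algebraType (@open 'rV[R]_n)).

Definition representing_measure (R : realType) (n t : nat)
    (phi : 'rV[R]_(nmidx n (2 * t)))
    (mu : {measure set (borel_space R n) -> \bar R}) : Prop :=
  forall a : midx n (2 * t),
    mu.-integrable [set: borel_space R n] (fun x => (monom x a)%:E) /\
    (\int[mu]_x (monom x a)%:E = (seq_at phi a)%:E)%E.

(* Main.v *)
Require Import Defs.
From HB Require Import structures.
From mathcomp Require Import all_boot all_order all_algebra.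
From mathcomp Require Import complex perm.
From mathcomp Require Import all_classical all_reals all_analysis.
From mathcomp Require Import measurable_realfun.
From mathcomp Require Import -(notations) mpoly.
From mathcomp Require Import ring lra zify.

Set Implicit Arguments.
Unset Strict Implicit.
Unset Printing Implicit Defensive.

Import Order.TTheory GRing.Theory Num.Theory.
Import numFieldNormedType.Exports.

Local Open Scope classical_set_scope.
Local Open Scope ring_scope.

(** For p in the interior of the SOS cone, the moment sequences phi in the dual
    cone with L_phi(p) = dim R[x]_t form a compact set.  A maximiser of det M(phi)
    over it has M(phi) positive definite, and stationarity in the direction psi
    says tr(M(phi)^-1 M(psi)) = L_psi(p) for all psi, i.e. the polynomial with
    Gram matrix M(phi)^-1 is p.  Conversely a positive definite Gram matrix stays
    positive definite under small perturbations, and every polynomial of degree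
    at most 2t close to the given one is reached by such a perturbation.

    In one variable, a polynomial P of degree t+1 orthogonal to all polynomials of
    degree at most t cannot be divisible by (X - a)^2 + b^2: with P = ((X-a)^2+b^2) Q
    one would get 0 = L(P Q) > 0.  Hence P has t+1 distinct real roots, and Gauss
    quadrature at these roots represents phi. *)

(** * Positive semidefinite matrices *)

Section BilinearForm.
Context {R : realType} {m : nat}.
Implicit Types (A B : 'M[R]_m) (u v w : 'cV[R]_m).

Definition bform A u v : R := (u^T *m A *m v) 0 0.

Lemma bformDl A u v w : bform A (u + v) w = bform A u w + bform A v w.
Proof. by rewrite /bform linearD /= !mulmxDl mxE. Qed.

Lemma bformDr A u v w : bform A w (u + v) = bform A w u + bform A w v.
Proof. by rewrite /bform mulmxDr mxE. Qed.

Lemma bformZl A c u v : bform A (c *: u) v = c * bform A u v.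
Proof. by rewrite /bform linearZ /= -!scalemxAl mxE. Qed.

Lemma bformZr A c u v : bform A u (c *: v) = c * bform A u v.
Proof. by rewrite /bform -scalemxAr mxE. Qed.

Lemma bformD A B u v : bform (A + B) u v = bform A u v + bform B u v.
Proof. by rewrite /bform mulmxDr mulmxDl mxE. Qed.

Lemma bformN A u v : bform (- A) u v = - bform A u v.
Proof. by rewrite /bform mulmxN mulNmx mxE. Qed.

Lemma bformZ A c u v : bform (c *: A) u v = c * bform A u v.
Proof. by rewrite /bform -scalemxAr -scalemxAl mxE. Qed.

Lemma mx11_tr (M : 'M[R]_1) : M 0 0 = M^T 0 0.
Proof. by rewrite mxE. Qed.

Lemma bformC A u v : A^T = A -> bform A u v = bform A v u.
Proof.
by move=> sA; rewrite /bform [LHS]mx11_tr !trmx_mul trmxK sA mulmxA mxE.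
Qed.

Lemma bformE A u v : bform A u v = \sum_i \sum_j u i 0 * A i j * v j 0.
Proof.
rewrite /bform mxE exchange_big /=; apply: eq_bigr => j _.
by rewrite mxE mulr_suml; apply: eq_bigr => i _; rewrite mxE.
Qed.

Lemma bform_delta A i j : bform A (delta_mx i 0) (delta_mx j 0) = A i j.
Proof. by rewrite /bform trmx_delta -rowE -colE !mxE. Qed.

Lemma bform_outer w v : bform (w *m w^T) v v = (bform 1%:M w v) ^+ 2.
Proof.
rewrite /bform mulmx1 mulmxA -mulmxA [LHS]mxE big_ord1 expr2; congr (_ * _).
by rewrite [LHS]mx11_tr trmx_mul trmxK mxE.
Qed.

(** The form is nonnegative on the span of [u] and [v]. At [- b *: u + a *: v] its value is
    [a * (a * c - b ^+ 2)], which settles the case [a > 0]. *)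
Lemma psd_cauchy_schwarz A u v : psdmx A ->
  (bform A u v) ^+ 2 <= bform A u u * bform A v v.
Proof.
move=> [sA pA].
have q c d : 0 <= c ^+ 2 * bform A u u + 2 * (c * d) * bform A u v
    + d ^+ 2 * bform A v v.
  have := pA (c *: u + d *: v); rewrite -/(bform _ _ _).
  rewrite bformDl !bformDr !bformZl !bformZr (bformC v u sA) => /le_trans; apply.
  by rewrite le_eqVlt; apply/orP; left; apply/eqP; ring.
have a0 : 0 <= bform A u u by apply: pA.
have c0 : 0 <= bform A v v by apply: pA.
set a := bform A u u in a0 q *; set b := bform A u v in q *.
set c := bform A v v in c0 q *.
move: a0; rewrite le_eqVlt => /orP[/eqP a0|a0]; last first.
  have := q (- b) a; have -> : (- b) ^+ 2 * a + 2 * (- b * a) * b + a ^+ 2 * c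
    = a * (a * c - b ^+ 2) by ring.
  by rewrite pmulr_rge0 // subr_ge0.
have [->|b0] := eqVneq b 0; first by rewrite expr0n /= mulr_ge0 // -a0.
(* For [a = 0] and [b != 0] the form is affine in its first argument, and this argument brings it
   down to [- 1]. *)
have := q (- (c + 1) / (2 * b)) 1; rewrite -a0.
have -> : (- (c + 1) / (2 * b)) ^+ 2 * 0 + 2 * (- (c + 1) / (2 * b) * 1) * b
  + 1 ^+ 2 * c = - 1 by field.
by lra.
Qed.

Lemma pd_psd A : pdmx A -> psdmx A.
Proof.
move=> [sA pA]; split=> // v; have [->|v0] := eqVneq v 0; last exact/ltW/pA.
by rewrite mulmx0 mxE.
Qed.

(** Cauchy-Schwarz against each basis vector kills each coordinate of [A *m v]. *)
Lemma psd_bform_eq0 A v : psdmx A -> bform A v v = 0 -> A *m v = 0.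
Proof.
move=> pA v0; apply/matrixP => i j; rewrite ord1 [RHS]mxE.
have := psd_cauchy_schwarz (delta_mx i 0) v pA.
rewrite v0 mulr0 => h.
have : (bform A (delta_mx i 0) v) ^+ 2 == 0.
  by rewrite eq_le h sqr_ge0.
by rewrite sqrf_eq0 /bform trmx_delta -mulmxA -rowE mxE => /eqP.
Qed.

Lemma pd_unitmx A : pdmx A -> A \in unitmx.
Proof.
move=> [sA pA]; rewrite -unitmx_tr -row_free_unit -kermx_eq0.
apply/eqP/row_matrixP => i; rewrite row0; apply/eqP.
apply: contraT => k0.
have /pA : (row i (kermx A^T))^T != 0 by rewrite trmx_eq0.
have /sub_kermxP : (row i (kermx A^T) <= kermx A^T)%MS by exact: row_sub.
by rewrite trmxK sA => ->; rewrite mul0mx mxE ltxx.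
Qed.

(** An isotropic vector of a semidefinite form lies in the kernel of its matrix. *)
Lemma psd_unit_pd A : psdmx A -> A \in unitmx -> pdmx A.
Proof.
move=> pA uA; have [sA qA] := pA; split=> // v v0; rewrite lt_neqAle qA andbT.
apply: contra v0; rewrite eq_sym => /eqP /(psd_bform_eq0 pA) h.
by rewrite -[v](mulKmx uA) h mulmx0.
Qed.

Lemma sym_invmx A : A^T = A -> (invmx A)^T = invmx A.
Proof. by move=> sA; rewrite trmx_inv sA. Qed.

Lemma pd_invmx A : pdmx A -> pdmx (invmx A).
Proof.
move=> pA; have uA := pd_unitmx pA; have [sA qA] := pA.
split; first exact: sym_invmx.
move=> v v0; have : invmx A *m v != 0.
  by apply: contra v0 => /eqP h; rewrite -[v](mulKVmx uA) h mulmx0.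
by move=> /qA; rewrite trmx_mul sym_invmx // -!mulmxA mulKVmx.
Qed.

(* Cauchy-Schwarz for A, since v_i is the A-product of v with A^-1 e_i. *)
Lemma pd_coord_le A v i : pdmx A ->
  v i 0 ^+ 2 <= invmx A i i * bform A v v.
Proof.
move=> pA; have uA := pd_unitmx pA; have [sA _] := pA.
have := psd_cauchy_schwarz (invmx A *m delta_mx i 0) v (pd_psd pA).
rewrite /bform trmx_mul sym_invmx // -!mulmxA mulKVmx // mulKmx // trmx_delta.
by rewrite -rowE mxE -colE -rowE 2!mxE.
Qed.

(** By [pd_coord_le], products of two coordinates of [v] are at most [T * bform A v v], with [T] the
    trace of the inverse. Hence a matrix with small entries cannot outweigh [A]. *)
Lemma pd_open A : pdmx A -> exists2 e : R, 0 < e &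
  forall B, B^T = B -> (forall i j, `|B i j| < e) -> pdmx (A + B).
Proof.
move=> pA; have [sA qA] := pA.
have pI := pd_invmx pA.
pose T := \sum_i invmx A i i.
have I0 i : 0 <= invmx A i i.
  by have [_ h] := pd_psd pI; have := h (delta_mx i 0); rewrite -/(bform _ _ _) bform_delta.
have T0 : 0 <= T by apply: sumr_ge0 => i _.
have vT v i : v i 0 ^+ 2 <= T * bform A v v.
  apply: (le_trans (pd_coord_le v i pA)).
  apply: ler_wpM2r; first by have [_ h] := pd_psd pA; exact: h.
  by rewrite /T (bigD1 i) //= lerDl sumr_ge0.
(* The added ones give [0 < K] and the strict bound [m^2 T < K] in every case, [m = 0] included. *)
pose K := (m%:R * m%:R + 1) * (T + 1).
have K0 : 0 < K by rewrite mulr_gt0 // ltr_wpDl // mulr_ge0.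
exists K^-1; first by rewrite invr_gt0.
move=> B sB hB; split; first by rewrite linearD /= sA sB.
move=> v v0; rewrite -/(bform _ _ _) bformD.
have q0 := qA v v0; rewrite -/(bform _ _ _) in q0.
set q := bform A v v in q0 *.
suff : `|bform B v v| < q by rewrite ltr_norml => /andP[]; lra.
have h1 : `|bform B v v| <= \sum_(i < m) \sum_(j < m) K^-1 * (T * q).
  rewrite bformE; apply: le_trans (ler_norm_sum _ _ _) _; apply: ler_sum => i _.
  apply: le_trans (ler_norm_sum _ _ _) _; apply: ler_sum => j _.
  rewrite -mulrA mulrCA normrM; apply: ler_pM => //; first exact/ltW/hB.
  (* The squares of the sum and of the difference give [2 |v_i v_j| <= v_i^2 + v_j^2]. *)
  rewrite ler_norml; have := vT v i; have := vT v j; rewrite -/q.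
  have := sqr_ge0 (v i 0 + v j 0); have := sqr_ge0 (v i 0 - v j 0).
  by rewrite sqrrB sqrrD => *; apply/andP; split; lra.
apply: le_lt_trans h1 _.
rewrite !sumr_const !card_ord -mulrnA -mulr_natl natrM.
rewrite mulrCA ltr_pdivrMl // mulrA ltr_pM2r //.
have : (0 : R) <= m%:R * m%:R by rewrite mulr_ge0.
rewrite /K; set M := m%:R * m%:R => M0.
have := mulr_ge0 M0 T0; lra.
Qed.

(* Subtracting the outer square of the column A e_i / sqrt(A_ii) keeps A positive
   semidefinite, by Cauchy-Schwarz, and clears row i. *)
Lemma psd_outer_sum A : psdmx A ->
  exists s : seq 'cV[R]_m, A = \sum_(u <- s) u *m u^T.
Proof.
have [k] := ubnP #|[set i | A i i != 0]%SET|.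
elim: k A => // k IH A; rewrite ltnS => hk pA; have [sA qA] := pA.
have [i Ai|A0] := pickP (fun i => A i i != 0); last first.
  (* With a zero diagonal every basis vector is isotropic, so every column vanishes. *)
  exists [::]; rewrite big_nil; apply/matrixP => i j; rewrite [RHS]mxE.
  have h : bform A (delta_mx j 0) (delta_mx j 0) = 0.
    by rewrite bform_delta; apply/eqP/negbFE/A0.
  have := psd_bform_eq0 pA h; rewrite -colE => /matrixP/(_ i 0).
  by rewrite !mxE.
have dE j : A j j = bform A (delta_mx j 0) (delta_mx j 0) by rewrite bform_delta.
have A0 j : 0 <= A j j by rewrite dE; exact: qA.
have Ai0 : 0 < A i i by rewrite lt_neqAle eq_sym Ai A0.
pose u := (Num.sqrt (A i i))^-1 *: col i A.
have uu : u *m u^T = (A i i)^-1 *: (col i A *m (col i A)^T).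
  rewrite linearZ /= -scalemxAr -scalemxAl scalerA -invfM -expr2 sqr_sqrtr //.
pose B := A - u *m u^T.
have BE j l : B j l = A j l - (A i i)^-1 * (A j i * A l i).
  by rewrite /B uu !mxE big_ord1 !mxE.
have pB : psdmx B.
  split; first by rewrite /B linearB /= trmx_mul trmxK sA.
  move=> v; rewrite -/(bform _ _ _) /B bformD bformN uu bformZ bform_outer.
  have := psd_cauchy_schwarz (delta_mx i 0) v pA.
  rewrite bform_delta.
  have -> : bform A (delta_mx i 0) v = bform 1%:M (col i A) v.
    by rewrite /bform mulmx1 trmx_delta -rowE tr_col sA.
  by rewrite subr_ge0 ler_pdivrMl.
case: (IH B _ pB) => [|s sE]; last first.
  by exists (u :: s); rewrite big_cons -sE /B addrC subrK.
(* The induction is on the number of nonzero diagonal entries. A zero entry stays zero because its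
   whole column in [A] vanishes, and entry [i] becomes zero. *)
apply: leq_trans hk; apply: proper_card; apply/properP; split.
  apply/fintype.subsetP => j; rewrite !inE; apply: contra => /eqP jj.
  have h : bform A (delta_mx j 0) (delta_mx j 0) = 0 by rewrite bform_delta.
  rewrite BE jj.
  have := psd_bform_eq0 pA h; rewrite -colE => /matrixP/(_ i 0).
  rewrite 2!mxE => Aij; have /matrixP/(_ j i) := sA.
  by rewrite mxE Aij => <-; rewrite !mul0r mulr0 subr0.
exists i; rewrite !inE // BE negbK mulrA mulVf // mul1r subrr //.
Qed.

End BilinearForm.

(** * Riesz functional and Gram matrices *)

Section Riesz.
Context {R : realType} {n : nat}.
Local Notation mpol := (mpoly n R).
Local Notation mX := (@mpolyX n R).

Definition mpolyc d (c : 'rV[R]_(nmidx n d)) : mpol :=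
  \sum_i c 0 i *: mX (enum_val i : midx n d).

Lemma mpolyc_deg d (c : 'rV[R]_(nmidx n d)) : mdeg_le d (mpolyc c).
Proof.
rewrite /mdeg_le; apply: leq_trans (msize_sum _ _ _) _.
apply/bigmax_leqP_seq => i _ _; apply: leq_trans (msizeZ_le _ _) _.
by rewrite msizeX; apply: bmdeg.
Qed.

Lemma mcoefsK d (p : mpol) : mdeg_le d p -> mpolyc (mcoefs d p) = p.
Proof.
move=> dp; rewrite [RHS](mpolywE dp) /mpolyc.
rewrite (reindex (@enum_rank (midx n d))) /=; last first.
  by exists enum_val => i _; rewrite ?enum_rankK ?enum_valK.
by apply: eq_bigr => a _; rewrite mxE enum_rankK.
Qed.

Lemma mpolycK d (c : 'rV[R]_(nmidx n d)) : mcoefs d (mpolyc c) = c.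
Proof.
apply/rowP => i; rewrite mxE raddf_sum /= (bigD1 i) //= big1 => [|j ji].
  by rewrite mcoeffZ mcoeffX eqxx mulr1 addr0.
by rewrite mcoeffZ mcoeffX -bmeqP (inj_eq enum_val_inj) (negbTE ji) mulr0.
Qed.

Definition riesz d (phi : 'rV[R]_(nmidx n d)) (p : mpol) : R :=
  \sum_i phi 0 i * mcoefs d p 0 i.

Lemma riesz_sum d (phi : 'rV[R]_(nmidx n d)) (I : Type) (s : seq I) P
    (F : I -> mpol) :
  riesz phi (\sum_(i <- s | P i) F i) = \sum_(i <- s | P i) riesz phi (F i).
Proof.
rewrite exchange_big; apply: eq_bigr => i _ /=; rewrite mxE raddf_sum mulr_sumr.
by apply: eq_bigr => j _; rewrite mxE.
Qed.

Lemma rieszZ d (phi : 'rV[R]_(nmidx n d)) c (p : mpol) :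
  riesz phi (c *: p) = c * riesz phi p.
Proof.
by rewrite mulr_sumr; apply: eq_bigr => i _; rewrite !mxE mcoeffZ mulrCA.
Qed.

Lemma rieszX d (phi : 'rV[R]_(nmidx n d)) (a : midx n d) :
  riesz phi (mX a) = seq_at phi a.
Proof.
rewrite /riesz (bigD1 (enum_rank a)) //= mxE enum_rankK mcoeffX eqxx mulr1.
rewrite big1 ?addr0 // => i ia; rewrite mxE mcoeffX.
rewrite -bmeqP; case: eqP => [ai|]; last by rewrite mulr0.
by rewrite ai enum_valK eqxx in ia.
Qed.

(** The polynomial [v_t^T A v_t]; several matrices can represent the same polynomial. *)
Definition gram t (A : 'M[R]_(nmidx n t)) : mpol :=
  \sum_i \sum_j A i j *: mX (madd (enum_val i) (enum_val j)).

Lemma gram_deg t (A : 'M[R]_(nmidx n t)) : mdeg_le (2 * t) (gram A).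
Proof.
rewrite /mdeg_le; apply: leq_trans (msize_sum _ _ _) _.
apply/bigmax_leqP_seq => i _ _; apply: leq_trans (msize_sum _ _ _) _.
apply/bigmax_leqP_seq => j _ _; apply: leq_trans (msizeZ_le _ _) _.
by rewrite msizeX; apply: bmdeg.
Qed.

Lemma gramD t (A B : 'M[R]_(nmidx n t)) : gram (A + B) = gram A + gram B.
Proof.
rewrite /gram -big_split; apply: eq_bigr => i _; rewrite -big_split.
by apply: eq_bigr => j _; rewrite mxE scalerDl.
Qed.

Lemma gram_sum t (I : Type) (s : seq I) (F : I -> 'M[R]_(nmidx n t)) :
  gram (\sum_(i <- s) F i) = \sum_(i <- s) gram (F i).
Proof.
elim: s => [|i s IH]; rewrite ?big_nil ?big_cons ?gramD ?IH //.
by rewrite /gram big1 // => i _; rewrite big1 // => j _; rewrite mxE scale0r.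
Qed.

Lemma gram_outer t (u : 'cV[R]_(nmidx n t)) :
  gram (u *m u^T) = mpolyc u^T ^+ 2.
Proof.
rewrite /gram expr2 /mpolyc mulr_suml; apply: eq_bigr => i _.
rewrite mulr_sumr; apply: eq_bigr => j _.
by rewrite !mxE big_ord1 !mxE -scalerAl -scalerAr scalerA mpolyXD.
Qed.

Lemma gram_psd_SOS t (A : 'M[R]_(nmidx n t)) : psdmx A -> SOS R n t (gram A).
Proof.
move=> /psd_outer_sum[s sE]; split; first exact: gram_deg.
exists [seq mpolyc u^T | u : 'cV_(nmidx n t) <- s].
by rewrite big_map sE gram_sum; apply: eq_bigr => u _; rewrite gram_outer.
Qed.

Lemma peval_sum (I : Type) (s : seq I) P (F : I -> mpol) x :
  peval (\sum_(i <- s | P i) F i) x = \sum_(i <- s | P i) peval (F i) x.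
Proof. exact: raddf_sum. Qed.

Lemma pevalZ c (p : mpol) x : peval (c *: p) x = c * peval p x.
Proof. exact: mevalZ. Qed.

Lemma pevalX a x : peval (mX a) x = monom x a.
Proof. by rewrite /peval mevalX. Qed.

Lemma monomD (x : 'rV[R]_n) a b : monom x (mnm_add a b) = monom x a * monom x b.
Proof. by rewrite -!pevalX mpolyXD /peval mevalM. Qed.

Lemma peval_gram t (A : 'M[R]_(nmidx n t)) x :
  peval (gram A) x = bform A (vmonom t x) (vmonom t x).
Proof.
rewrite bformE peval_sum; apply: eq_bigr => i _; rewrite peval_sum.
by apply: eq_bigr => j _; rewrite pevalZ pevalX monomD !mxE mulrCA mulrA.
Qed.

Lemma moment_mx_sym t (phi : 'rV[R]_(nmidx n (2 * t))) :
  (moment_mx phi)^T = moment_mx phi.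
Proof.
apply/matrixP => i j; rewrite !mxE; congr seq_at; apply: val_inj => /=.
exact: addmC.
Qed.

(** [gram] is the adjoint of [moment_mx] for the trace pairing. This turns stationarity of the
    determinant into an identity between polynomials. *)
Lemma riesz_gram t (phi : 'rV[R]_(nmidx n (2 * t))) A :
  riesz phi (gram A) = \tr (A *m moment_mx phi).
Proof.
rewrite riesz_sum; apply: eq_bigr => i _; rewrite riesz_sum mxE.
apply: eq_bigr => j _; rewrite rieszZ rieszX -[in RHS]moment_mx_sym.
by rewrite mxE mxE.
Qed.

Lemma riesz_sqr t (phi : 'rV[R]_(nmidx n (2 * t))) u :
  riesz phi (mpolyc u^T ^+ 2) = bform (moment_mx phi) u u.
Proof.
rewrite -gram_outer riesz_gram -mulmxA mxtrace_mulC /mxtrace big_ord1.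
by rewrite /bform.
Qed.

(* The coefficient of the sum at twice the largest leading exponent is a sum of
   squares of leading coefficients, hence nonzero. *)
Lemma msize_sqr_sum t (s : seq mpol) :
  mdeg_le (2 * t) (\sum_(q <- s) q ^+ 2) ->
  forall q, q \in s -> mdeg_le t q.
Proof.
move=> ds q qs; rewrite /mdeg_le.
have [q0 q0s hq0] : exists2 q0, q0 \in s &
    forall q, q \in s -> (mlead q <= mlead q0)%O.
  elim: s {ds} q qs => // a s IH q _.
  have [->|[b bs]] : s = [::] \/ exists b, b \in s.
  - by case: s {IH} => [|b s]; [left|right; exists b; rewrite mem_head].
  - by exists a; rewrite ?mem_head // => r; rewrite inE => /eqP ->.
  have [q0 q0s h] := IH b bs.
  have [l|l] := leP (mlead a) (mlead q0).
    exists q0; first by rewrite inE q0s orbT.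
    by move=> r; rewrite inE => /orP[/eqP ->|/h].
  exists a; first by rewrite mem_head.
  move=> r; rewrite inE => /orP[/eqP ->//|/h rq0].
  exact: le_trans rq0 (ltW l).
have [->|qn0] := eqVneq q 0; first by rewrite msize0.
rewrite -mlead_deg // ltnS; apply: leq_trans (lemc_mdeg (hq0 _ qs)) _.
have [->|q0n0] := eqVneq q0 0; first by rewrite mlead0 mdeg0.
set m := mlead q0.
suff : mcoeff (mnm_add m m) (\sum_(q <- s) q ^+ 2) != 0.
  rewrite -mcoeff_msupp => /msize_mdeg_lt /leq_trans/(_ ds).
  by rewrite ltnS mdegD addnn -mul2n leq_pmul2l.
rewrite raddf_sum /=.
(* No leading exponent exceeds [m], so only the product of the two coefficients at [m] reaches the
   exponent [m + m]. *)
have E r : r \in s -> mcoeff (mnm_add m m) (r ^+ 2) = (mcoeff m r) ^+ 2.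
  by move=> rs; rewrite expr2 mleadcMW ?hq0 // -expr2.
rewrite big_seq psumr_neq0; last by move=> r rs; rewrite /= E // sqr_ge0.
apply/hasP; exists q0 => //; rewrite q0s /= E //.
by rewrite exprn_even_gt0 // mleadc_eq0.
Qed.

(** By [msize_sqr_sum] each [q] has degree at most [t], so the functional on its square is a value
    of the quadratic form of the moment matrix. *)
Lemma riesz_SOS_ge0 t (phi : 'rV[R]_(nmidx n (2 * t))) (p : mpol) :
  SOS_dual R n t phi -> SOS R n t p -> 0 <= riesz phi p.
Proof.
move=> [_ pphi] [dp [s pE]]; rewrite pE in dp *.
rewrite riesz_sum big_seq; apply: sumr_ge0 => q qs.
have := msize_sqr_sum dp qs; move/mcoefsK => <-.
by rewrite -[mcoefs _ _]trmxK riesz_sqr; apply: pphi.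
Qed.

End Riesz.

(** * Kronecker substitution *)

(** Uniqueness of base [B] digits: the lowest one is the residue modulo [B]. *)
Lemma digits_inj (n B : nat) (f g : 'I_n -> nat) :
  (forall i, (f i < B)%N) -> (forall i, (g i < B)%N) ->
  (\sum_i f i * B ^ i = \sum_i g i * B ^ i)%N -> f =1 g.
Proof.
elim: n f g => [|n IH] f g fB gB; first by move=> _ [].
have E h : (\sum_(i < n.+1) h i * B ^ i
    = h ord0 + B * \sum_(i < n) h (lift ord0 i) * B ^ i)%N.
  rewrite big_ord_recl /= expn0 muln1 big_distrr /=; congr (_ + _)%N.
  by apply: eq_bigr => i _; rewrite /bump /= expnS mulnCA.
rewrite !E => e.
have e0 : f ord0 = g ord0.
  have := congr1 (fun k => k %% B)%N e.
  by rewrite ![(_ + B * _)%N]addnC ![(B * _)%N]mulnC !modnMDl !modn_small.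
have B0 : (0 < B)%N by apply: leq_ltn_trans (fB ord0).
move/eqP: e; rewrite e0 eqn_add2l eqn_pmul2l // => /eqP/IH h i.
have [j ->|->//] := unliftP ord0 i.
by apply: h => k; [apply: fB|apply: gB].
Qed.

Section Kronecker.
Context {R : realType} {n : nat}.
Local Notation mpol := (mpoly n R).
Implicit Types (B : nat) (p : mpol).

(** The exponents read as digits in base [B]: substituting [y^(B^i)] for [x_i] keeps monomials of
    degree less than [B] apart. *)
Definition kron B (a : multinom n) : nat := (\sum_(i < n) a i * B ^ i)%N.

Definition kcurve B (y : R) : 'rV[R]_n := \row_i y ^+ (B ^ i).

Lemma monom_kcurve B y a : monom (kcurve B y) a = y ^+ kron B a.
Proof.
rewrite /kron -prodrXr; apply: eq_bigr => i _.
by rewrite mxE -exprM mulnC.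
Qed.

Lemma kron_lt B a : (mdeg a < B)%N -> (kron B a < B * B ^ n)%N.
Proof.
move=> aB; have B0 : (0 < B)%N by apply: leq_ltn_trans aB.
apply: (@leq_ltn_trans (mdeg a * B ^ n)); last by rewrite ltn_pmul2r ?expn_gt0 ?B0.
rewrite mdegE big_distrl /=; apply: leq_sum => i _.
by rewrite leq_mul2l leq_pexp2l ?orbT // ltnW.
Qed.

Lemma kron_inj B a b : (mdeg a < B)%N -> (mdeg b < B)%N ->
  kron B a = kron B b -> a = b.
Proof.
move=> aB bB e; apply/mnmP; apply: digits_inj e => i.
  by apply: leq_ltn_trans aB; rewrite mdegE (bigD1 i) //= leq_addr.
by apply: leq_ltn_trans bB; rewrite mdegE (bigD1 i) //= leq_addr.
Qed.

(** On the curve, [p] becomes a nonzero univariate polynomial of size at most [B * B ^ n], which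
    cannot vanish at that many distinct integers. *)
Lemma kcurve_neq0 B p : (msize p <= B)%N -> p != 0 ->
  exists y : 'I_(B * B ^ n), peval p (kcurve B y%:R) != 0.
Proof.
move=> pB p0.
pose P : {poly R} := \sum_(a <- msupp p) mcoeff a p *: 'X^(kron B a).
have PE y : peval p (kcurve B y) = P.[y].
  rewrite {1}[p]mpolyE peval_sum horner_sum; apply: eq_bigr => a _.
  by rewrite pevalZ pevalX hornerZ hornerXn monom_kcurve.
have aB a : a \in msupp p -> (mdeg a < B)%N.
  by move=> /msize_mdeg_lt /leq_trans; apply.
have lp := mlead_supp p0.
(* By injectivity of [kron], the leading monomial of [p] alone contributes to the coefficient at its
   image. *)
have P0 : P != 0.
  apply/eqP => /polyP/(_ (kron B (mlead p))); rewrite coef0 coef_sum.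
  rewrite (bigD1_seq (mlead p)) ?msupp_uniq //= coefZ coefXn eqxx mulr1.
  rewrite big_seq_cond big1 => [|a /andP[ap al]].
    by rewrite addr0; apply/eqP; rewrite mleadc_eq0.
  rewrite coefZ coefXn eq_sym; case: eqP => [e|]; last by rewrite mulr0.
  by rewrite (kron_inj _ _ e) ?aB // eqxx in al.
have sP : (size P <= B * B ^ n)%N.
  rewrite (leq_trans (size_sum _ _ _)) //; apply/bigmax_leqP_seq => a ap _.
  by rewrite (leq_trans (size_scale_leq _ _)) // size_polyXn kron_lt // aB.
apply/existsP; apply: contraT; rewrite negb_exists => /forallP h.
pose rs := [seq (val y)%:R : R | y <- enum 'I_(B * B ^ n)].
have : (size rs < size P)%N.
  apply: max_poly_roots => //.
    by apply/allP => _ /mapP[y _ ->]; rewrite /root -PE; have := h y; rewrite negbK.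
  by rewrite map_inj_uniq ?enum_uniq // => i j /eqP; rewrite eqr_nat => /eqP/val_inj.
by rewrite size_map size_enum_ord ltnNge sP.
Qed.

Lemma peval_inj p q : (forall x, peval p x = peval q x) -> p = q.
Proof.
move=> pq; apply/eqP; rewrite -subr_eq0; apply: contraT => h.
have [y] := kcurve_neq0 (leqnn _) h.
by rewrite /peval mevalB -!/(peval _ _) pq subrr eqxx.
Qed.

(* The sum of the point evaluations at enough points of the Kronecker curve to
   separate the polynomials of degree at most t. *)
Definition grid_moments t : 'rV[R]_(nmidx n (2 * t)) :=
  \row_i \sum_(y < t.+1 * t.+1 ^ n) monom (kcurve t.+1 y%:R) (enum_val i : midx n (2 * t)).

Lemma grid_moments_pd t : pdmx (moment_mx (grid_moments t)).
Proof.
split=> [|v v0]; first exact: moment_mx_sym.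
have E : moment_mx (grid_moments t) = \sum_(y < t.+1 * t.+1 ^ n)
    vmonom t (kcurve t.+1 y%:R) *m (vmonom t (kcurve t.+1 y%:R))^T.
  apply/matrixP => i j; rewrite summxE mxE /seq_at mxE enum_rankK; apply: eq_bigr => y _.
  by rewrite monomD !mxE big_ord1 !mxE.
have pE x : peval (mpolyc v^T) x = bform 1%:M (vmonom t x) v.
  rewrite peval_sum /bform mulmx1 mxE; apply: eq_bigr => i _.
  by rewrite pevalZ pevalX !mxE mulrC.
(* A zero of this sum of squares would be a polynomial of degree at most [t] vanishing at all the
   nodes, contrary to [kcurve_neq0]. *)
have F : bform (moment_mx (grid_moments t)) v v =
    \sum_(y < t.+1 * t.+1 ^ n) peval (mpolyc v^T) (kcurve t.+1 y%:R) ^+ 2.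
  rewrite E /bform mulmx_sumr mulmx_suml summxE; apply: eq_bigr => y _.
  by rewrite -/(bform _ _ _) bform_outer pE.
have [||y hy] := @kcurve_neq0 t.+1 (mpolyc v^T); first exact: mpolyc_deg.
  apply: contra v0 => /eqP h; rewrite -trmx_eq0 -(mpolycK v^T) h.
  by apply/eqP/rowP => i; rewrite !mxE mcoeff0.
rewrite -/(bform _ _ _) F (bigD1 y) //= ltr_pwDl ?exprn_even_gt0 //.
by apply: sumr_ge0 => i _; apply: sqr_ge0.
Qed.

Lemma mnm_sub_deg (m : multinom n) k : (k <= mdeg m)%N ->
  exists2 a : multinom n, (forall i, (a i <= m i)%N) & mdeg a = k.
Proof.
elim: k => [|k IH] km; first by exists mnm0; rewrite ?mdeg0 // => i; rewrite mnm0E.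
have [a am ak] := IH (ltnW km).
have [i ai] : exists i, (a i < m i)%N.
  apply/existsP; apply: contraT; rewrite negb_exists => /forallP h.
  suff : (mdeg m <= mdeg a)%N by rewrite leqNgt ak km.
  by rewrite !mdegE; apply: leq_sum => i _; rewrite leqNgt h.
exists (mnm_add a (mnm1 i)); last by rewrite mdegD mdeg1 ak addn1.
move=> j; rewrite mnmDE mnm1E; case: eqP => [<-|_]; first by rewrite addn1.
by rewrite addn0.
Qed.

(** Take below [c] an index of degree [minn t (mdeg c)]; the remainder has degree at most [t]. *)
Lemma madd_surj t (c : midx n (2 * t)) : exists a b : midx n t, madd a b = c.
Proof.
have [a am ak] := mnm_sub_deg (geq_minr t (mdeg c)).
have ac : mnm_add a (mnm_sub c a) = c.
  by apply/mnmP => i; rewrite mnmDE mnmBE subnKC.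
have at_ : (mdeg a < t.+1)%N by rewrite ak ltnS geq_minl.
have bt : (mdeg (mnm_sub c a) < t.+1)%N.
  have := bmdeg c; rewrite -{1}ac mdegD ak !ltnS => h.
  by move: h ak; rewrite -{1}ac mdegD; lia.
by exists (BMultinom at_), (BMultinom bt); apply: val_inj.
Qed.

End Kronecker.

(** * Determinants along lines *)

Lemma interior_rVP (R : realType) k (A : set 'rV[R]_k) (x : 'rV[R]_k) :
  interior A x <-> exists2 e : R, 0 < e &
    forall y : 'rV[R]_k, (forall i, `|y 0 i - x 0 i| < e) -> A y.
Proof.
split=> [/nbhs_ballP[e /= e0 eA]|[e e0 eA]].
  exists e => // y xy; apply: eA; split => // i j.
  by rewrite ord1 /ball /= distrC; apply: xy.
apply/nbhs_ballP; exists e => //= y [_ xy]; apply: eA => i.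
by have := xy 0 i; rewrite /ball /= distrC.
Qed.

Lemma interior_line (R : realType) k (A : set 'rV[R]_k) (x d : 'rV[R]_k) :
  interior A x -> exists2 e : R, 0 < e & forall s, `|s| < e -> A (x + s *: d).
Proof.
move=> /interior_rVP[e e0 eA].
pose K := 1 + \sum_i `|d 0 i|.
have K0 : 0 < K by rewrite ltr_pwDl // sumr_ge0.
exists (e / K); first exact: divr_gt0.
move=> s; rewrite ltr_pdivlMr // => sK; apply: eA => i.
rewrite !mxE addrAC subrr add0r normrM; apply: le_lt_trans sK.
by rewrite ler_wpM2l // /K (bigD1 i) //= addrCA lerDl ?addr_ge0 ?sumr_ge0.
Qed.

Section Perturbation.
Context {R : realType}.

(** First-order optimality without derivatives: near 0 the remainder [Q.[s] * s ^+ 2] cannot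
    compensate a nonzero linear term. *)
Lemma poly_max_coef1 (P : {poly R}) (e : R) : 0 < e ->
  (forall s, `|s| < e -> P.[s] <= P.[0]) -> P`_1 = 0.
Proof.
move=> e0 h; pose Q := drop_poly 2 P.
pose K := 1 + \sum_(i < size Q) `|Q`_i|.
have K0 : 0 < K by rewrite ltr_pwDl // sumr_ge0.
have QK s : `|s| <= 1 -> `|Q.[s]| <= K.
  move=> s1; rewrite horner_coef; apply: le_trans (ler_norm_sum _ _ _) _.
  apply: le_trans (_ : \sum_(i < size Q) `|Q`_i| <= _); last by rewrite /K lerDr.
  by apply: ler_sum => i _; rewrite normrM normrX ler_piMr // exprn_ile1.
have PE s : P.[s] = P`_0 + P`_1 * s + Q.[s] * s ^+ 2.
  rewrite -[in LHS](poly_take_drop 2 P) hornerD hornerM hornerXn.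
  congr (_ + _); rewrite (@horner_coef_wide _ 2) ?size_take_poly //.
  by rewrite big_ord_recl big_ord1 !coef_take_poly /= expr0 mulr1 expr1.
apply/eqP; apply: contraT => a0.
have na0 : 0 < `|P`_1| by rewrite normr_gt0.
(* The last bound makes the linear gain at least [2 K r^2], against a loss of at most [K r^2]. *)
pose r := Num.min (Num.min (e / 2) 1) (`|P`_1| / (2 * K)).
have r0 : 0 < r by rewrite !lt_min ltr01 !divr_gt0 ?mulr_gt0.
have nr : `|Num.sg P`_1 * r| = r.
  by rewrite normrM normr_sg a0 mul1r gtr0_norm.
have re : r < e.
  by apply: (@le_lt_trans _ _ (e / 2)); [rewrite !ge_min lexx|lra].
have r1 : r <= 1 by rewrite !ge_min lexx orbT.
have ra : r * (2 * K) <= `|P`_1|.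
  by rewrite -ler_pdivlMr ?mulr_gt0 // !ge_min lexx orbT.
have := h (Num.sg P`_1 * r); rewrite nr => /(_ re).
rewrite !PE mulr0 expr0n mulr0 !addr0 mulrA [P`_1 * _]mulrC -normrEsg.
have := QK (Num.sg P`_1 * r); rewrite nr => /(_ r1).
rewrite exprMn sqr_sg a0 mul1r ler_norml => /andP[+ _].
set q := Q.[_] => qK H.
have H1 : - K * r ^+ 2 <= q * r ^+ 2 by rewrite ler_wpM2r ?sqr_ge0.
have H2 : r * (2 * K) * r <= `|P`_1| * r by rewrite ler_wpM2r // ltW.
have H3 : 0 < K * r ^+ 2 by rewrite mulr_gt0 ?exprn_gt0.
have : r * (2 * K) * r = K * r ^+ 2 + K * r ^+ 2 by ring.
lra.
Qed.

Lemma horner_char_poly m (C : 'M[R]_m) x : (char_poly C).[x] = \det (x%:M - C).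
Proof.
rewrite -[LHS]/(horner_eval x _) -det_map_mx; congr (\det _).
apply/matrixP => i j; rewrite !mxE /= /horner_eval.
by rewrite hornerD hornerN hornerC hornerMn hornerX.
Qed.

(* P is the characteristic polynomial of - C with its coefficients reversed. *)
Lemma det_1sub_poly m (C : 'M[R]_m.+1) : exists P : {poly R},
  [/\ P`_0 = 1, P`_1 = \tr C & forall s, P.[s] = \det (1%:M + s *: C)].
Proof.
pose c := char_poly C.
have sc : size c = m.+2 := size_char_poly C.
have cm : c`_m.+1 = 1 by have /monicP := char_poly_monic C; rewrite lead_coefE sc.
have ct : c`_m = - \tr C := char_poly_trace C (ltn0Sn m).
pose P := \sum_(k < m.+2) c`_k *: ((-1) ^+ (m.+1 - k) *: 'X^(m.+1 - k)) : {poly R}.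
have PE s : P.[s] = \sum_(k < m.+2) c`_k * (- s) ^+ (m.+1 - k).
  rewrite horner_sum; apply: eq_bigr => k _.
  by rewrite !hornerZ hornerXn -exprMn mulN1r.
have P0 : P`_0 = 1.
  rewrite coef_sum big_ord_recr /= !coefZ subnn !expr0 coef1 cm !mul1r big1 ?add0r //.
  by move=> i _; rewrite !coefZ coefXn eq_sym subn_eq0 leqNgt ltnS -ltnS ltn_ord !mulr0.
exists P; split=> // [|s].
  rewrite coef_sum !big_ord_recr /= !coefZ subnn subSnn !expr0 coefXn coef1 expr1 ct.
  rewrite big1 => [|i _]; first by rewrite /= !mulr0 addr0 add0r mulr1 mulrN1 opprK.
  rewrite !coefZ coefXn; case: eqP => [e|]; last by rewrite !mulr0.
  by have := ltn_ord i; lia.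
have [->|s0] := eqVneq s 0.
  by rewrite horner_coef0 P0 scale0r addr0 det1.
(* The characteristic matrix at [- s^-1] appears, hence the separate case [s = 0]. *)
have -> : 1%:M + s *: C = - s *: ((- s^-1)%:M - C).
  by rewrite scalerBr scale_scalar_mx mulrNN divff // scaleNr opprK.
rewrite PE detZ -horner_char_poly -/c horner_coef sc mulr_sumr.
apply: eq_bigr => k _; rewrite mulrCA; congr (_ * _).
have ks : (k <= m.+1)%N by rewrite -ltnS.
have -> : (- s) ^+ m.+1 = (- s) ^+ (m.+1 - k) * (- s) ^+ k by rewrite -exprD subnK.
by rewrite -mulrA -exprMn mulrNN divff // expr1n mulr1.
Qed.

(** After division by [\det A ^+ 2], the squared determinant is a polynomial in [s] with linear
    coefficient twice the trace. *)
Lemma det_sqr_max_trace m (A B : 'M[R]_m) (e : R) : A \in unitmx -> 0 < e ->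
  (forall s, `|s| < e -> \det (A + s *: B) ^+ 2 <= \det A ^+ 2) ->
  \tr (invmx A *m B) = 0.
Proof.
case: m A B => [|m] A B uA e0 h; first by rewrite /mxtrace big_ord0.
have [P [P0 P1 PE]] := det_1sub_poly (invmx A *m B).
have dA : \det A != 0 by rewrite -unitfE -unitmxE.
suff : (P ^+ 2)`_1 = 0.
  rewrite expr2 coefM big_ord_recl big_ord1 /= P0 P1 mul1r mulr1 => e1; lra.
apply: (poly_max_coef1 e0) => s se.
have := h s se; have -> : A + s *: B = A *m (1%:M + s *: (invmx A *m B)).
  by rewrite mulmxDr mulmx1 -scalemxAr mulKVmx.
rewrite det_mulmx exprMn -{2}[\det A ^+ 2]mulr1 ler_pM2l ?exprn_even_gt0 //.
by rewrite !hornerE PE -/(_ ^+ 2) [P.[0]]horner_coef0 P0 expr1n -PE.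
Qed.

End Perturbation.

(** * The SOS cone and its dual *)

Section MomentCone.
Context {R : realType} {n : nat}.
Local Notation mpol := (mpoly n R).
Implicit Types (t : nat) (p : mpol).

Lemma moment_mxD t (phi psi : 'rV[R]_(nmidx n (2 * t))) :
  moment_mx (phi + psi) = moment_mx phi + moment_mx psi.
Proof. by apply/matrixP => i j; rewrite !mxE /seq_at mxE. Qed.

Lemma moment_mxZ t c (phi : 'rV[R]_(nmidx n (2 * t))) :
  moment_mx (c *: phi) = c *: moment_mx phi.
Proof. by apply/matrixP => i j; rewrite !mxE /seq_at mxE. Qed.

Lemma rieszDl t (phi psi : 'rV[R]_(nmidx n t)) p :
  riesz (phi + psi) p = riesz phi p + riesz psi p.
Proof. by rewrite -big_split; apply: eq_bigr => i _; rewrite mxE mulrDl. Qed.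

Lemma rieszZl t c (phi : 'rV[R]_(nmidx n t)) p :
  riesz (c *: phi) p = c * riesz phi p.
Proof. by rewrite mulr_sumr; apply: eq_bigr => i _; rewrite mxE mulrA. Qed.

(** Subtracting a small multiple of [grid_moments t] would make the form negative on an isotropic
    vector. *)
Lemma interior_dual_pd t (phi : 'rV[R]_(nmidx n (2 * t))) :
  interior (SOS_dual R n t) phi -> pdmx (moment_mx phi).
Proof.
move=> iphi; have pphi : psdmx (moment_mx phi) := interior_subset iphi.
split=> [|v v0]; first exact: moment_mx_sym.
rewrite lt_neqAle (pphi.2 v) andbT; apply/eqP => e0.
have [e e_gt0 /(_ (- (e / 2)))] := interior_line (grid_moments t) iphi.
rewrite normrN gtr0_norm ?divr_gt0 // => /(_ _)[]; first by lra.
move=> _ /(_ v); rewrite -/(bform _ _ _) moment_mxD moment_mxZ bformD bformZ.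
rewrite {1}/bform -e0 add0r mulNr oppr_ge0 leNgt mulr_gt0 ?divr_gt0 //.
by have [_] := @grid_moments_pd R n t; apply.
Qed.

Lemma pd_interior_dual t (phi : 'rV[R]_(nmidx n (2 * t))) :
  pdmx (moment_mx phi) -> interior (SOS_dual R n t) phi.
Proof.
move=> /pd_open[e e0 h]; apply/interior_rVP; exists e => // psi psie.
rewrite -(subrK phi psi) addrC /SOS_dual /= moment_mxD; apply/pd_psd/h.
  exact: moment_mx_sym.
by move=> i j; rewrite mxE /seq_at mxE [X in _ + X]mxE.
Qed.

(** The map from sequences to coefficients is diagonal: entry [c] is multiplied by the number of
    ways to write [c] as a sum of two indices. *)
Lemma gram_moment_mx t (psi : 'rV[R]_(nmidx n (2 * t))) (c : midx n (2 * t)) :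
  mcoeff c (gram (moment_mx psi)) =
  \sum_(i < nmidx n t) \sum_(j < nmidx n t) seq_at psi c *
    (madd (enum_val i) (enum_val j) == c)%:R.
Proof.
rewrite raddf_sum; apply: eq_bigr => i _; rewrite raddf_sum; apply: eq_bigr => j _.
rewrite [LHS]mcoeffZ mcoeffX -bmeqP mxE; case: eqP => [->//|_].
by rewrite !mulr0.
Qed.

Lemma gram_pd_interior t (A : 'M[R]_(nmidx n t)) :
  pdmx A -> SOS_int R n t (gram A).
Proof.
move=> pA; split; first exact: gram_deg.
have [e e0 h] := pd_open pA; apply/interior_rVP; exists e => // c ce.
(* psi is chosen so that its moment matrix, used as a Gram matrix, spreads each
   missing coefficient evenly over the entries contributing to it. *)
pose mult (a : midx n (2 * t)) : R :=
  \sum_(i < nmidx n t) \sum_(j < nmidx n t)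
    (madd (enum_val i) (enum_val j) == a)%:R.
(* Surjectivity of [madd] makes the division by [mult] legitimate; it only shrinks the entries,
   which stay below [e]. *)
have mult1 a : 1 <= mult a.
  have [b [b' bb]] := madd_surj a.
  rewrite /mult (bigD1 (enum_rank b)) //= (bigD1 (enum_rank b')) //=.
  rewrite !enum_rankK bb eqxx -addrA lerDl addr_ge0 ?sumr_ge0 // => i _.
  by rewrite sumr_ge0.
have mult0 a : mult a != 0 by rewrite gt_eqF // (lt_le_trans ltr01).
pose psi : 'rV[R]_(nmidx n (2 * t)) :=
  \row_i ((c 0 i - mcoefs (2 * t) (gram A) 0 i) / mult (enum_val i)).
exists (gram (A + moment_mx psi)).
  apply/gram_psd_SOS/pd_psd/h; first exact: moment_mx_sym.
  move=> i j; rewrite mxE /seq_at mxE normrM.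
  set k := enum_rank _; apply: le_lt_trans (ce k).
  rewrite ler_piMr // normfV ger0_norm ?(le_trans ler01) //.
  by rewrite invf_le1 // (lt_le_trans ltr01).
apply/rowP => k; rewrite mxE gramD mcoeffD gram_moment_mx.
under eq_bigr do rewrite -mulr_sumr.
rewrite -mulr_sumr -/(mult _) /seq_at enum_valK !mxE.
by rewrite mulfVK // addrC subrK.
Qed.

(** With [phi] read as a coefficient vector, [p - s phi] is still SOS for some [s > 0], and the
    functional takes the value [L(p) - s |phi|^2 >= 0] on it. *)
Lemma riesz_interior_gt0 t (phi : 'rV[R]_(nmidx n (2 * t))) p :
  SOS_dual R n t phi -> phi != 0 -> SOS_int R n t p -> 0 < riesz phi p.
Proof.
move=> dphi phi0 [_ ip].
have [e e0 /(_ (- (e / 2)))] := interior_line phi ip.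
rewrite normrN gtr0_norm ?divr_gt0 // => /(_ _)[]; first by lra.
move=> q Sq qE; have := riesz_SOS_ge0 dphi Sq.
rewrite /riesz qE.
under eq_bigr do rewrite mxE [X in _ + X]mxE mulrDr.
rewrite big_split /=; under [X in _ + X]eq_bigr do rewrite mulrCA -expr2.
rewrite -mulr_sumr mulNr subr_ge0 => /(lt_le_trans _); apply.
rewrite mulr_gt0 ?divr_gt0 // lt_neqAle eq_sym.
rewrite sumr_ge0 ?andbT => [|i _]; last exact: sqr_ge0.
apply: contra phi0 => /eqP s0; apply/eqP/rowP => i; rewrite mxE; apply/eqP.
rewrite -sqrf_eq0; apply/eqP.
have := psumr_eq0P _ s0; apply=> // j _; exact: sqr_ge0.
Qed.

(** Both [p + (e/2) x^a] and [p - (e/2) x^a] are SOS, so the functional is nonnegative on them;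
    hence the constant [2 / e]. *)
Lemma riesz_bound t p : SOS_int R n t p ->
  exists2 K : R, 0 < K & forall phi : 'rV[R]_(nmidx n (2 * t)),
    SOS_dual R n t phi -> forall i, `|phi 0 i| <= K * riesz phi p.
Proof.
move=> [_ /interior_rVP[e e0 he]]; exists (2 / e); first exact: divr_gt0.
move=> phi dphi i.
have key s : `|s| <= e / 2 -> 0 <= riesz phi p + s * phi 0 i.
  move=> se; have [j|q Sq qE] := he (mcoefs (2 * t) p + s *: delta_mx 0 i).
    rewrite !mxE addrAC subrr add0r normrM normr_nat eqxx /=.
    apply: le_lt_trans (_ : e / 2 < e); last by lra.
    by apply: le_trans se; rewrite ler_piMr //; case: (j == i).
  have := riesz_SOS_ge0 dphi Sq; rewrite /riesz qE.
  under eq_bigr do rewrite mxE mulrDr.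
  rewrite big_split /= [X in _ + X](_ : _ = s * phi 0 i) //.
  rewrite (bigD1 i) //= big1 ?addr0 => [|j ji]; rewrite !mxE eqxx.
    by rewrite eqxx mulr1 mulrC.
  by rewrite (negbTE ji) !mulr0.
have e2 : 0 < e / 2 by rewrite divr_gt0.
have k1 := key (e / 2); have k2 := key (- (e / 2)).
rewrite normrN in k2; rewrite gtr0_norm // lexx in k1 k2.
rewrite -ler_pdivrMl ?divr_gt0 // invf_div -(gtr0_norm e2) -normrM ler_norml.
by have := k1 isT; have := k2 isT => *; apply/andP; split; lra.
Qed.

Lemma continuous_riesz t p :
  continuous (fun phi : 'rV[R]_(nmidx n t) => riesz phi p).
Proof.
apply: (@continuous_big R _ +%R 0 xpredT _ _ _
  (fun i (phi : 'rV[R]_(nmidx n t)) => phi 0 i * mcoefs t p 0 i)) => [|i _].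
  exact: add_continuous.
move=> phi; apply: continuousM; last exact: cst_continuous.
exact: coord_continuous.
Qed.

Lemma continuous_det_moment_mx t :
  continuous (fun phi : 'rV[R]_(nmidx n (2 * t)) => \det (moment_mx phi)).
Proof.
apply: (@continuous_big R _ +%R 0 xpredT _ _ _
  (fun (s : {perm 'I_(nmidx n t)}) (phi : 'rV[R]_(nmidx n (2 * t))) =>
    (-1) ^+ odd_perm s * \prod_i moment_mx phi i (s i))) => [|s _].
  exact: add_continuous.
move=> phi; apply: (@continuousM R _ (fun=> (-1) ^+ odd_perm s)
  (fun phi : 'rV[R]_(nmidx n (2 * t)) => \prod_i moment_mx phi i (s i))).
  exact: cst_continuous.
apply: (@continuous_big R _ *%R 1 xpredT _ _ _ (fun i (phi : 'rV[R]_(nmidx n (2 * t))) =>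
  moment_mx phi i (s i))) => [|i _].
  exact: mul_continuous.
move=> {}phi; rewrite /continuous_at mxE; under eq_cvg do rewrite mxE.
exact: coord_continuous.
Qed.

(** An intersection of closed half-spaces, one for each square. *)
Lemma closed_SOS_dual t : closed (SOS_dual R n t).
Proof.
have -> : SOS_dual R n t = \bigcap_(v in [set: 'cV[R]_(nmidx n t)])
    ((fun phi => riesz phi (mpolyc v^T ^+ 2)) @^-1` [set x | 0 <= x]).
  apply/seteqP; split => [phi [_ h] v _|phi h] /=; first by rewrite riesz_sqr; apply: h.
  split; first exact: moment_mx_sym.
  by move=> v; have := h v I; rewrite /= riesz_sqr.
apply: closed_bigI => v _; apply: closed_comp; last exact: closed_ge.
by move=> phi _; apply: continuous_riesz.
Qed.

Lemma nmidx_gt0 t : (0 < nmidx n t)%N.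
Proof. by apply/card_gt0P; exists bm0. Qed.

(* The squared determinant is maximised rather than the determinant, whose sign
   would otherwise have to be discussed. *)
Lemma int_SOS_christoffel t p : SOS_int R n t p ->
  exists2 phi : 'rV[R]_(nmidx n (2 * t)), pdmx (moment_mx phi) &
    p = gram (invmx (moment_mx phi)).
Proof.
move=> ip; have [dp _] := ip.
(* The trace of the identity: with this normalisation [p] and [gram (invmx M)] agree against [phi]
   itself. *)
pose d : R := (nmidx n t)%:R.
have d0 : 0 < d by rewrite ltr0n nmidx_gt0.
pose S := SOS_dual R n t `&` [set phi | riesz phi p = d].
have g0 : 0 < riesz (grid_moments t) p.
  apply: riesz_interior_gt0 => //; first exact/pd_psd/grid_moments_pd.
  apply/eqP => g0; have := mulVmx (pd_unitmx (@grid_moments_pd R n t)).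
  rewrite {2}g0 -(scale0r 0) moment_mxZ scale0r mulmx0 => /(congr1 mxtrace).
  by rewrite mxtrace0 mxtrace1 => /esym/eqP; rewrite gt_eqF.
have gS : S ((d / riesz (grid_moments t) p) *: grid_moments t).
  split; last by rewrite /= rieszZl divfK // gt_eqF.
  have [_ h] := pd_psd (@grid_moments_pd R n t).
  split; first exact: moment_mx_sym.
  move=> v; rewrite -/(bform _ _ _) moment_mxZ bformZ mulr_ge0 ?h //.
  by rewrite divr_ge0 ?ltW.
have cS : compact S.
  have [K K0 hK] := riesz_bound ip.
  apply: (subclosed_compact _ (rV_compact (fun=> @segment_compact R (- (K * d)) (K * d)))).
    apply: closedI; first exact: closed_SOS_dual.
    apply: (@closed_comp _ _ (fun phi => riesz phi p) [set x | x = d]).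
      by move=> phi _; apply: continuous_riesz.
    exact: closed_eq.
  by move=> phi [dphi /= pd] i; rewrite /= in_itv /= -ler_norml -pd; apply: hK.
have cdet : continuous (fun phi : 'rV[R]_(nmidx n (2 * t)) =>
    \det (moment_mx phi) ^+ 2).
  move=> phi; apply: (@continuousM R _ (fun phi => \det (moment_mx phi))
    (fun phi => \det (moment_mx phi))); exact: continuous_det_moment_mx.
have [phi /set_mem[dphi phid] phimax] := @EVT_max_rV R _
  (fun phi => \det (moment_mx phi) ^+ 2) S (ex_intro _ _ gS) cS
  (continuous_subspaceT cdet).
set M := moment_mx phi in phimax.
(* The maximum is at least the value at the rescaled grid functional, which is positive. *)
have uM : M \in unitmx.
  rewrite unitmxE unitfE -sqrf_eq0 gt_eqF //.
  apply: lt_le_trans (phimax _ (mem_set gS)).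
  rewrite moment_mxZ detZ exprn_even_gt0 //= mulf_neq0 ?expf_neq0 //.
    by rewrite mulf_neq0 ?invr_eq0 ?gt_eqF.
  by rewrite -unitfE -unitmxE; apply/pd_unitmx/grid_moments_pd.
have pM : pdmx M := psd_unit_pd dphi uM.
exists phi => //.
have tr0 (psi : 'rV[R]_(nmidx n (2 * t))) : riesz psi p = 0 -> \tr (invmx M *m moment_mx psi) = 0.
  move=> psi0; have [e e0 he] := interior_line psi (pd_interior_dual pM).
  apply: (det_sqr_max_trace uM e0) => s se.
  rewrite -moment_mxZ -moment_mxD; apply/phimax/mem_set; split; first exact: he.
  by rewrite /= rieszDl rieszZl psi0 mulr0 addr0.
(* Subtracting a multiple of [phi] from [psi] gives a direction tangent to the slice, where [tr0]
   applies. *)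
have rE (psi : 'rV[R]_(nmidx n (2 * t))) : riesz psi p = riesz psi (gram (invmx M)).
  rewrite riesz_gram.
  have := tr0 (psi - (riesz psi p / d) *: phi).
  rewrite rieszDl -scaleNr rieszZl phid mulNr divfK ?gt_eqF // subrr => /(_ erefl).
  rewrite moment_mxD moment_mxZ mulmxDr mxtraceD -scalemxAr mxtraceZ mulVmx //.
  by rewrite mxtrace1 -/d mulNr divfK ?gt_eqF // => /subr0_eq.
rewrite -(mcoefsK dp) -(mcoefsK (gram_deg (invmx M))); congr mpolyc.
apply/rowP => i; have := rE (delta_mx 0 i).
have dE q : riesz (delta_mx 0 i) q = mcoefs (2 * t) q 0 i.
  rewrite /riesz (bigD1 i) //= mxE !eqxx mul1r big1 ?addr0 // => j ji.
  by rewrite mxE (negbTE ji) andbF mul0r.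
by rewrite !dE.
Qed.

End MomentCone.

(** * Gauss quadrature *)

Section Quadrature.
Context {R : realType}.
Implicit Types (p q : {poly R}) (s : seq R) (m : nat -> R).

(** The value [b = 0] is allowed, so that double real roots and pairs of conjugate roots are treated
    alike. *)
Definition quad (a b : R) : {poly R} := ('X - a%:P) ^+ 2 + (b ^+ 2)%:P.

Lemma quad_monic a b : quad a b \is monic.
Proof.
have h : (size (b ^+ 2)%:P < size (('X - a%:P) ^+ 2))%N.
  by rewrite size_exp_XsubC (leq_ltn_trans (size_polyC_leq1 _)).
by rewrite /quad monicE lead_coefDl // -monicE monic_exp ?monicXsubC.
Qed.

Lemma size_quad a b : size (quad a b) = 3%N.
Proof.
rewrite /quad size_polyDl; first by rewrite size_exp_XsubC.
by rewrite size_exp_XsubC (leq_ltn_trans (size_polyC_leq1 _)).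
Qed.

(** The remainder modulo [quad a b] is affine with real coefficients and vanishes at a nonreal
    point, so it is zero. *)
Lemma complex_root_dvd p (a b : R) : b != 0 ->
  root (map_poly (real_complex R) p) (Complex a b) -> quad a b %| p.
Proof.
move=> b0; set rc := real_complex R; set z := Complex a b.
have zq : (map_poly rc (quad a b)).[z] = 0.
  rewrite rmorphD rmorphXn rmorphB /= map_polyX !map_polyC /= !hornerE.
  apply/eqP; rewrite eq_complex; apply/andP; split; apply/eqP => /=.
    by rewrite /= ; ring.
  by rewrite /=; ring.
have q0 : quad a b != 0 by rewrite -size_poly_eq0 size_quad.
rewrite rootE {1}(divp_eq p (quad a b)) rmorphD rmorphM /= hornerD hornerM zq.
rewrite mulr0 add0r => /eqP; set r := p %% _ => rz.
have sr : (size r <= 2)%N by rewrite -ltnS -(size_quad a b) ltn_modp.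
rewrite /dvdp -/r; apply/eqP.
have rE : r = (r`_0)%:P + r`_1 *: 'X.
  apply/polyP => i; rewrite coefD coefC coefZ coefX.
  case: i => [|[|i]]; rewrite /= ?mulr0 ?mulr1 ?addr0 ?add0r //.
  by rewrite nth_default // (leq_trans sr).
move: rz; rewrite rE -mul_polyC rmorphD rmorphM /= map_polyX !map_polyC /= !hornerE.
move/eqP; rewrite eq_complex /= => /andP[/eqP e1 /eqP e2].
have r1 : r`_1 = 0.
  apply/eqP; have : r`_1 * b == 0 by apply/eqP; move: e2; rewrite /=; lra.
  by rewrite mulf_eq0 (negbTE b0) orbF.
have r0 : r`_0 = 0 by move: e1; rewrite r1; lra.
by rewrite r0 r1 mul0r addr0.
Qed.

Lemma real_split_or_quad p : p \is monic ->
  (exists a b, quad a b %| p) \/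
  (exists2 s, uniq s & p = \prod_(x <- s) ('X - x%:P)).
Proof.
have [n] := ubnP (size p); elim: n p => // n IH p; rewrite ltnS => sp mp.
have [s1|s1] := eqVneq (size p) 1%N.
  right; exists [::] => //; rewrite big_nil.
  move/eqP/size_poly1P: s1 => [c _ pE]; move: mp.
  by rewrite pE monicE lead_coefC => /eqP ->.
have /closed_rootP[[a b] rz] : size (map_poly (real_complex R) p) != 1%N.
  by rewrite size_map_poly.
have [b0|b0] := eqVneq b 0; last first.
  by left; exists a, b; apply: complex_root_dvd.
rewrite b0 -[Complex a 0]/(real_complex R a) fmorph_root in rz.
move/factor_theorem: rz => [q pE].
have mq : q \is monic by move: mp; rewrite pE monicMr // monicXsubC.
have sq : (size q < n)%N.
  apply: leq_trans sp; rewrite pE size_Mmonic ?monicXsubC ?monic_neq0 //.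
  by rewrite size_XsubC addn2.
have [[c [d cd]]|[s us qE]] := IH q sq mq.
  by left; exists c, d; rewrite pE dvdp_mulr.
(* A repeated real root gives the divisor [quad a 0]. *)
have [as_|as_] := boolP (a \in s).
  left; exists a, 0; rewrite /quad expr0n addr0 pE expr2 dvdp_mul2r ?polyXsubC_eq0 //.
  by rewrite qE (big_rem a) //= dvdp_mulr.
right; exists (a :: s); first by rewrite /= as_.
by rewrite big_cons pE qE mulrC.
Qed.

(* The functional sending X^i to m i. *)
Definition mfun m p : R := \sum_(i < size p) p`_i * m i.

Lemma mfun_wide m p n : (size p <= n)%N -> mfun m p = \sum_(i < n) p`_i * m i.
Proof.
move=> pn; rewrite /mfun (big_ord_widen n (fun i => p`_i * m i)) // big_mkcond.
apply: eq_bigr => i _; case: ltnP => // h; by rewrite nth_default // mul0r.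
Qed.

Lemma mfunD m p q : mfun m (p + q) = mfun m p + mfun m q.
Proof.
pose n := maxn (size p) (size q).
rewrite !(@mfun_wide _ _ n) ?leq_maxl ?leq_maxr ?size_polyD // -big_split.
by apply: eq_bigr => i _; rewrite coefD mulrDl.
Qed.

Lemma mfunZ m c p : mfun m (c *: p) = c * mfun m p.
Proof.
rewrite !(@mfun_wide _ _ (size p)) ?size_scale_leq // mulr_sumr.
by apply: eq_bigr => i _; rewrite coefZ mulrA.
Qed.

Lemma mfun0 m : mfun m 0 = 0.
Proof. by rewrite /mfun size_poly0 big_ord0. Qed.

Lemma mfun_sum m (I : Type) (r : seq I) P (F : I -> {poly R}) :
  mfun m (\sum_(i <- r | P i) F i) = \sum_(i <- r | P i) mfun m (F i).
Proof. exact: (big_morph _ (mfunD m) (mfun0 m)). Qed.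

Lemma mfunXn m k : mfun m 'X^k = m k.
Proof.
rewrite (@mfun_wide _ _ k.+1) ?size_polyXn // big_ord_recr /= big1 => [|i _].
  by rewrite coefXn eqxx mul1r add0r.
by rewrite coefXn ltn_eqF ?mul0r.
Qed.

Definition pos_on t m := forall q, (size q <= t.+1)%N -> q != 0 -> 0 < mfun m (q ^+ 2).

(** The lower coefficients solve a linear system whose matrix is the Hankel matrix [H], invertible
    by positivity. *)
Lemma orthogonal_poly t m : pos_on t m -> exists2 p, p \is monic /\ size p = t.+2 &
  forall q, (size q <= t.+1)%N -> mfun m (p * q) = 0.
Proof.
move=> posm.
pose H : 'M[R]_t.+1 := \matrix_(i, j) m (i + j)%N.
have HE u v : bform H u v = mfun m (rVpoly u^T * rVpoly v^T).
  have rE (w : 'cV[R]_t.+1) : rVpoly w^T = \sum_i w i 0 *: 'X^i.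
    by rewrite /rVpoly poly_def; apply: eq_bigr => i _; rewrite valK mxE.
  rewrite bformE !rE mulr_suml mfun_sum; apply: eq_bigr => i _.
  rewrite mulr_sumr mfun_sum; apply: eq_bigr => j _.
  rewrite -[in RHS]scalerAr -[in RHS]scalerAl !mfunZ.
  by rewrite -exprD mfunXn mxE; ring.
have pH : pdmx H.
  split=> [|v v0]; first by apply/matrixP => i j; rewrite !mxE addnC.
  rewrite -/(bform _ _ _) HE; apply: posm; first exact: size_poly.
  by rewrite -trmx_eq0 in v0; apply: contra v0 => /eqP h; rewrite -[v^T]rVpolyK h linear0.
have uH := pd_unitmx pH.
pose b : 'cV[R]_t.+1 := \col_i m (t.+1 + i)%N.
pose c := - (invmx H *m b).
pose p := 'X^(t.+1) + rVpoly c^T.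
have sc : (size (rVpoly c^T) < size ('X^(t.+1) : {poly R}))%N.
  by rewrite size_polyXn ltnS size_poly.
have sp : size p = t.+2 by rewrite /p size_polyDl // size_polyXn.
exists p.
  split=> //; rewrite monicE /p lead_coefDl // lead_coefXn //.
move=> q sq; rewrite -(poly_rV_K sq) -[poly_rV q]trmxK.
set v := (poly_rV q)^T.
rewrite mulrDl mfunD -HE bformC; last by have [] := pH.
rewrite /c /bform mulmxN -mulmxA mulKVmx // mxE.
apply/eqP; rewrite subr_eq0; apply/eqP.
rewrite mxE /rVpoly poly_def mulr_sumr mfun_sum; apply: eq_bigr => i _.
by rewrite valK -[in LHS]scalerAr mfunZ -exprD mfunXn !mxE.
Qed.

Lemma quadrature t m : pos_on t m -> exists (s : seq R) (w : R -> R),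
  (forall x, 0 <= w x) /\
  forall k, (k <= 2 * t)%N -> m k = \sum_(x <- s) w x * x ^+ k.
Proof.
move=> posm; have [p [mp sp] op] := orthogonal_poly posm.
have [[a [b /dvdpP[q pE]]]|[s us pE]] := real_split_or_quad mp.
  have q0 : q != 0.
    by apply: contraTneq mp => q0; rewrite pE q0 mul0r monicE lead_coef0 eq_sym oner_eq0.
  have sq : (size q).+1 = t.+1.
    by move: sp; rewrite pE size_Mmonic ?quad_monic // size_quad addn3 /= => -[->].
  have := op q; rewrite -sq => /(_ (leqnSn _)).
  have -> : p * q = (('X - a%:P) * q) ^+ 2 + (b *: q) ^+ 2.
    by rewrite pE /quad exprZn -mul_polyC; ring.
  rewrite mfunD => /eqP; rewrite gt_eqF // ltr_pwDl //.
    apply: posm; last by rewrite mulf_neq0 ?polyXsubC_eq0.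
    by rewrite size_monicM ?monicXsubC // size_XsubC add2n /= sq.
  have [->|bq] := eqVneq (b *: q) 0; first by rewrite expr0n mfun0.
  by apply/ltW/posm => //; rewrite (leq_trans (size_scale_leq _ _)) // -sq.
have ss : size s = t.+1 by move: sp; rewrite pE size_prod_XsubC => -[].
(* Normalised by its value at [x], this is the Lagrange basis at the roots of [p]. *)
pose g x := \prod_(y <- s | y != x) ('X - y%:P).
pose l x := (g x).[x]^-1 *: g x.
have gx x : (g x).[x] != 0.
  rewrite horner_prod prodf_seq_neq0; apply/allP => y _; apply/implyP => yx.
  by rewrite hornerXsubC subr_eq0 eq_sym.
have lx x : (l x).[x] = 1 by rewrite hornerZ mulVf.
have lz x z : z \in s -> z != x -> (l x).[z] = 0.
  move=> zs zx; rewrite hornerZ; suff -> : (g x).[z] = 0 by rewrite mulr0.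
  by rewrite horner_prod (big_rem z) //= zx hornerXsubC subrr mul0r.
have sl x : x \in s -> (size (l x) <= t.+1)%N.
  move=> xs; apply: leq_trans (size_scale_leq _ _) _.
  rewrite /g -big_filter size_prod_XsubC -(rem_filter _ us) size_rem // ss //.
(* In the division of [f] by [p], the quotient has degree at most [t] and is killed by
   orthogonality, and the remainder is interpolated at the roots. Exactness thus reaches degree
   [2t + 1]. *)
have exact (f : {poly R}) : (size f <= 2 * t.+1)%N ->
    mfun m f = \sum_(x <- s) f.[x] * mfun m (l x).
  move=> sf.
  have sr : (size (f %% p)%R <= t.+1)%N.
    by rewrite -ltnS -sp ltn_modp monic_neq0.
  have frE x : x \in s -> f.[x] = (f %% p).[x].
    move=> xs; rewrite {1}(divp_eq f p) hornerD hornerM pE.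
    suff -> : (\prod_(x <- s) ('X - x%:P)).[x] = 0 by rewrite mulr0 add0r.
    by apply/eqP; rewrite -/(root _ _) root_prod_XsubC.
  have lag : f %% p = \sum_(x <- s) f.[x] *: l x.
    apply/eqP; rewrite -subr_eq0; apply: contraT => d0.
    have : (size s < size (f %% p - \sum_(x <- s) f.[x] *: l x)%R)%N.
      apply: max_poly_roots => //; apply/allP => z zs.
      rewrite rootE hornerD hornerN horner_sum (bigD1_seq z) //= hornerZ lx mulr1.
      rewrite big1_seq => [|x /andP[xz xs]]; first by rewrite addr0 frE // subrr.
      by rewrite hornerZ lz ?mulr0 // eq_sym.
    rewrite ltnNge ss (leq_trans (size_polyD _ _)) // geq_max sr size_polyN.
    rewrite (leq_trans (size_sum _ _ _)) //; apply/bigmax_leqP_seq => x xs _.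
    by rewrite (leq_trans (size_scale_leq _ _)) ?sl.
  rewrite {1}(divp_eq f p) mfunD mulrC op ?add0r; last first.
    by rewrite size_divp ?monic_neq0 // sp /= leq_subLR addnn -mul2n sf.
  by rewrite lag mfun_sum; apply: eq_bigr => x _; rewrite mfunZ.
exists s, (fun x => `|mfun m (l x)|); split=> // k kt.
rewrite -(mfunXn m) exact ?size_polyXn; last by lia.
rewrite !big_seq; apply: eq_bigr => x xs; rewrite hornerXn mulrC ger0_norm //.
have l0 : l x != 0.
  by apply/eqP => l0; move: (lx x); rewrite l0 horner0 => /eqP; rewrite eq_sym oner_eq0.
(* The absolute value changes no weight at a node: the rule is exact on [l x ^+ 2], which equals 1
   at [x] and 0 at the other nodes. *)
suff -> : mfun m (l x) = mfun m (l x ^+ 2) by apply/ltW/posm/l0/sl.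
rewrite [RHS]exact; last first.
  apply: leq_trans (size_poly_exp_leq _ _) _; rewrite -subn1 mulnC -addn1.
  apply: (@leq_trans (2 * t + 1)); last by lia.
  by rewrite leq_add2r leq_pmul2l // leq_subLR add1n sl.
rewrite (bigD1_seq x) //= big1_seq => [|z /andP[zx zs]].
  by rewrite expr2 hornerM lx !mul1r addr0.
by rewrite expr2 hornerM lz // !mul0r.
Qed.

End Quadrature.

(** * Representing measures *)

Lemma continuous_monom (R : realType) n (a : multinom n) :
  continuous (fun x : 'rV[R]_n => monom x a).
Proof.
apply: (@continuous_big R _ *%R 1 xpredT _ _ _
  (fun i (x : 'rV[R]_n) => x 0 i ^+ a i)) => [|i _].
  exact: mul_continuous.
move=> x; apply: (@continuous_comp _ _ _ (fun x : 'rV[R]_n => x 0 i) (fun y => y ^+ a i)).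
  exact: coord_continuous.
exact: exprn_continuous.
Qed.

Lemma continuous_borel_measurable (R : realType) n (f : 'rV[R]_n -> R) :
  continuous f -> measurable_fun [set: borel_space R n] (f : borel_space R n -> R).
Proof.
move=> /continuousP cf; apply: (measurability _ (RGenOpens.measurableE R)).
move=> _ [_ [a [b ->] <-]]; rewrite setTI; apply: sub_sigma_algebra.
exact/cf/interval_open.
Qed.

Section DiscreteMeasure.
Context {R : realType} {d : measure_display} {T : measurableType d}.
Variables (s : seq R) (w : R -> R) (e : R -> T).

(* The absolute value only makes the weights nonnegative by construction. *)
Definition atoms : {measure set T -> \bar R} :=
  msum (fun k => mscale (NngNum (normr_ge0 (w s`_k))) (dirac (e s`_k))) (size s).

Lemma ge0_integral_atoms (f : T -> \bar R) : measurable_fun setT f ->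
  (forall x, 0 <= f x)%E ->
  (\int[atoms]_x f x = \sum_(k < size s) `|w s`_k|%:E * f (e s`_k))%E.
Proof.
move=> mf f0; rewrite ge0_integral_measure_sum //.
apply: eq_bigr => k _; rewrite ge0_integral_mscale //.
by rewrite integral_dirac // diracT mul1e.
Qed.

Lemma integrable_atoms (f : T -> R) : measurable_fun setT f ->
  atoms.-integrable setT (EFin \o f).
Proof.
move=> mf; have mf' : measurable_fun setT (EFin \o f) by exact/measurable_EFinP.
apply/integrableP; split=> //.
rewrite ge0_integral_atoms //; last exact: measurableT_comp.
by rewrite sumEFin ltry.
Qed.

Lemma integral_atoms (f : T -> R) : measurable_fun setT f ->
  (\int[atoms]_x (f x)%:E = (\sum_(x <- s) `|w x| * f (e x))%:E)%E.
Proof.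
move=> mf; have mf' : measurable_fun setT (EFin \o f) by exact/measurable_EFinP.
rewrite integralE !ge0_integral_atoms //; last first.
- exact: measurable_funepos.
- exact: measurable_funeneg.
rewrite (big_nth 0) big_mkord.
have posE x : ((EFin \o f)^\+ x = (Num.max (f x) 0)%:E)%E by rewrite funeposE EFin_max.
have negE x : ((EFin \o f)^\- x = (Num.max (- f x) 0)%:E)%E by rewrite funenegE EFin_max.
under eq_bigr do rewrite posE -EFinM.
under [X in (_ - X)%E]eq_bigr do rewrite negE -EFinM.
rewrite !sumEFin -EFinB -sumrB; congr EFin; apply: eq_bigr => k _.
rewrite -mulrBr; congr (_ * _); set y := f _.
case: (leP y 0) => y0; [rewrite max_l ?oppr_ge0|rewrite max_r ?oppr_le0 ?ltW //] => //; lra.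
Qed.
End DiscreteMeasure.

Lemma quadrature_representing (R : realType) t (phi : 'rV[R]_(nmidx 1 (2 * t))) :
  pdmx (moment_mx phi) -> exists mu, representing_measure phi mu.
Proof.
move=> pM.
pose c k : multinom 1 := mnm_muln (mnm1 ord0) k.
have cK (a : multinom 1) : c (a ord0) = a.
  by apply/mnmP => i; rewrite (ord1 i) mulmnE mnm1E eqxx mul1n.
have c0 k : c k ord0 = k by rewrite mulmnE mnm1E eqxx mul1n.
have cdeg k : mdeg (c k) = k by rewrite mdegE big_ord1 c0.
have dega (a : multinom 1) : mdeg a = a ord0 by rewrite mdegE big_ord1.
(* Beyond [2 * t] this gives 0. The value at [2t + 1] enters the orthogonal polynomial, while
   positivity involves only exponents up to [2t]. *)
pose m k := riesz phi (@mpolyX 1 R (c k)).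
have posm : pos_on t m.
  move=> q sq q0.
  pose Q := \sum_(k < size q) q`_k *: @mpolyX 1 R (c k).
  have dQ : mdeg_le t Q.
    rewrite /mdeg_le; apply: leq_trans (msize_sum _ _ _) _.
    apply/bigmax_leqP_seq => k _ _; apply: leq_trans (msizeZ_le _ _) _.
    by rewrite msizeX cdeg; apply: leq_trans (ltn_ord k) sq.
  have -> : mfun m (q ^+ 2) = riesz phi (Q ^+ 2).
    have {1}-> : q = \sum_(k < size q) q`_k *: 'X^k by rewrite -poly_def coefK.
    rewrite !expr2 !mulr_suml mfun_sum riesz_sum; apply: eq_bigr => i _.
    rewrite !mulr_sumr mfun_sum riesz_sum; apply: eq_bigr => j _.
    rewrite -[in LHS]scalerAr -[in LHS]scalerAl -[in RHS]scalerAr -[in RHS]scalerAl.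
    rewrite !mfunZ !rieszZ -exprD mfunXn -mpolyXD /m.
    do 2 congr (_ * _); congr (riesz _ (mpolyX _ _)).
    by apply/mnmP => l; rewrite (ord1 l) mnmDE !c0.
  rewrite -(mcoefsK dQ) -[mcoefs t Q]trmxK riesz_sqr; apply: pM.2.
  rewrite trmx_eq0; apply: contra q0 => /eqP Q0; apply/eqP/polyP => k.
  rewrite coef0; have [kq|kq] := ltnP k (size q); last by rewrite nth_default.
  have : mcoeff (c k) Q = 0.
    by rewrite -(mcoefsK dQ) Q0 /mpolyc big1 ?mcoeff0 // => i _; rewrite mxE scale0r.
  rewrite raddf_sum (bigD1 (Ordinal kq)) //= mcoeffZ mcoeffX eqxx mulr1 big1 ?addr0 //.
  move=> i ik; rewrite mcoeffZ mcoeffX.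
  have [ck|ck] := eqVneq (c i) (c k); [|by rewrite /= mulr0].
  by move: ik; rewrite -val_eqE /= -(c0 i) ck c0 eqxx.
have [s [w [w0 mE]]] := quadrature posm.
pose e (x : R) : borel_space R 1 := const_mx x.
exists (atoms s w e) => a.
have mon : measurable_fun [set: borel_space R 1] (fun x : borel_space R 1 => monom x a).
  exact: (continuous_borel_measurable (continuous_monom (a := a))).
split; first exact: integrable_atoms.
rewrite integral_atoms // -rieszX; congr EFin.
rewrite -[X in riesz _ (mpolyX _ X)]cK -/(m _) mE; last first.
  by rewrite -ltnS -dega bmdeg.
apply: eq_bigr => x _; rewrite ger0_norm //; congr (_ * _).
by rewrite /monom /mmap1 big_ord1 mxE.
Qed.

Theorem lemma2p3 (R : realType) (t : nat) :
  (forall (n : nat) (p : mpoly n R), (1 <= n)%N ->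
     (SOS_int R n t p <->
        exists phi : 'rV[R]_(nmidx n (2 * t)),
          interior (SOS_dual R n t) phi /\
          forall x : 'rV[R]_n,
            peval p x =
            ((vmonom t x)^T *m invmx (moment_mx phi) *m vmonom t x) 0 0) /\
     (SOS_int R n t p ->
        exists phi : 'rV[R]_(nmidx n (2 * t)),
          interior (SOS_dual R n t) phi /\
          is_christoffel phi (fun x => (peval p x)^-1))) /\
  (forall p : mpoly 1 R, SOS_int R 1 t p ->
     (forall phi : 'rV[R]_(nmidx 1 (2 * t)),
        interior (SOS_dual R 1 t) phi ->
        (forall x : 'rV[R]_1,
           peval p x =
           ((vmonom t x)^T *m invmx (moment_mx phi) *m vmonom t x) 0 0) ->
        exists mu : {measure set (borel_space R 1) -> \bar R},
          representing_measure phi mu /\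
          is_christoffel phi (fun x => (peval p x)^-1)) /\
     (exists (phi : 'rV[R]_(nmidx 1 (2 * t)))
             (mu : {measure set (borel_space R 1) -> \bar R}),
        interior (SOS_dual R 1 t) phi /\
        representing_measure phi mu /\
        is_christoffel phi (fun x => (peval p x)^-1))).
Proof.
have int_pd n (p : mpoly n R) : SOS_int R n t p ->
    exists phi : 'rV[R]_(nmidx n (2 * t)), interior (SOS_dual R n t) phi /\
      forall x : 'rV[R]_n, peval p x =
        ((vmonom t x)^T *m invmx (moment_mx phi) *m vmonom t x) 0 0.
  move=> /int_SOS_christoffel[phi pM ->]; exists phi.
  by split=> [|x]; [exact: pd_interior_dual|exact: peval_gram].
have chris n (p : mpoly n R) (phi : 'rV[R]_(nmidx n (2 * t))) :
    interior (SOS_dual R n t) phi ->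
    (forall x, peval p x =
      ((vmonom t x)^T *m invmx (moment_mx phi) *m vmonom t x) 0 0) ->
    is_christoffel phi (fun x => (peval p x)^-1).
  move=> iphi pE; split; first exact: interior_dual_pd.
  by move=> x; rewrite pE.
split=> [n p _|p ip].
  split.
    split; first exact: int_pd.
    move=> [phi [/interior_dual_pd pM pE]].
    have -> : p = gram (invmx (moment_mx phi)).
      (* Equality of values at all points gives equality of polynomials, so [gram_pd_interior]
         applies to [p]. *)
      by apply: peval_inj => x; rewrite peval_gram pE.
    exact/gram_pd_interior/pd_invmx.
  move=> /int_pd[phi [iphi pE]]; exists phi.
  by split=> //; apply: chris.
have rep (phi : 'rV[R]_(nmidx 1 (2 * t))) : interior (SOS_dual R 1 t) phi ->
    exists mu, representing_measure phi mu.
  by move=> /interior_dual_pd; exact: quadrature_representing.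
split=> [phi iphi pE|].
  have [mu mur] := rep phi iphi.
  by exists mu; split=> //; apply: chris.
have [phi [iphi pE]] := int_pd _ _ ip; have [mu mur] := rep phi iphi.
by exists phi, mu; do 2 split=> //; apply: chris.
Qed.
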